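(* Let $G=(V,E)$ be a complete undirected graph whose vertices are points of the Euclidean plane, with Euclidean edge weights $w_e$, let $m=|E|$, and let $\alpha\in(0,2\pi]$. Let $\mathcal{F}_{xy}^*\subseteq\mathbb{R}^{m}\times\mathbb{R}^{2m}$ and $\mathcal{F}_x^+\subseteq\mathbb{R}^m$ be the polyhedra defined in the context, and let $\mathrm{Proj}_x(\mathcal{F}_{xy}^* )=\{\mathbf{x}\in\mathbb{R}^m:\ \exists\,\mathbf{y}\in\mathbb{R}^{2m},\ (\mathbf{x},\mathbf{y})\in\mathcal{F}_{xy}^*\}$. Then $$\mathrm{Proj}_x(\mathcal{F}_{xy}^* )\subseteq\mathcal{F}_x^+,$$ and consequently $w(\mathcal{F}_x^+)\le w(\mathcal{F}_{xy}^* )$.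
   Context: $G=(V,E)$ is a complete undirected graph with $n=|V|$ vertices and $m=|E|$ edges; the vertices are pairwise distinct points of the Euclidean plane and $w_e$ is the Euclidean distance between the endpoints of $e\in E$. For $i\in V$, $\delta(i)$ is the set of edges incident to $i$; for $S\subseteq V$, $E(S)$ is the set of edges with both endpoints in $S$. Angles: for $i\ne j$ in $V$, $\measuredangle_{0ij}\in[0,2\pi)$ is the anti-clockwise angle from the direction $(1,0)$ to the direction of the vector from $i$ to $j$. For $j,k\in V\setminus\{i\}$, $\measuredangle_{jik}=\measuredangle_{0ik}-\measuredangle_{0ij}$ if $\measuredangle_{0ik}\ge\measuredangle_{0ij}$, and $\measuredangle_{jik}=2\pi+\measuredangle_{0ik}-\measuredangle_{0ij}$ otherwise (so $\measuredangle_{jik}\in[0,2\pi)$ is the angle needed to rotate the direction $i\to j$ anti-clockwise to the direction $i\to k$, and $\measuredangle_{jij}=0$). For $i\neq j$, $L_{ij}=\{j\}\cup\{k\in V\setminus\{i,j\}:\measuredangle_{kij}\le\alpha\}$. $\mathcal{F}_{\mathcal{T}}$ is the set of $\mathbf{x}=(x_e)_{e\in E}\in\mathbb{R}^m$ with $\sum_{e\in E}x_e=n-1$; $\sum_{e\in E(S)}x_e\le|S|-1$ for all $\emptyset\ne S\subsetneq V$; $x_e\ge0$ for all $e\in E$. $\mathcal{F}_{xy}^*$ is the set of $(\mathbf{x},\mathbf{y})$, where $\mathbf{y}=(y_{ij})$ is indexed by ordered pairs $(i,j)$ of distinct vertices (so $\mathbf{y}\in\mathbb{R}^{2m}$), such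 that $\mathbf{x}\in\mathcal{F}_{\mathcal{T}}$; $\sum_{j\in V\setminus\{i\}}y_{ij}=1$ for all $i\in V$; $x_e\le\sum_{k\in L_{ij}}y_{ik}$ for all $i\in V$ and $e=\{i,j\}\in\delta(i)$; and $y_{ij}\ge0$ for all $i\ne j$. For $i\in V$, nonempty $s(i)\subseteq\delta(i)$ and $\{i,j\}\in\delta(i)$, let $v_{ij}^{(s(i),\alpha)}=\left|\{\{i,k\}\in s(i):\measuredangle_{jik}\le\alpha\}\right|$ and $v^{(s(i),\alpha)}=\max\{v_{ij}^{(s(i),\alpha)}:\{i,j\}\in s(i)\}$. $\mathcal{F}_x^+$ is the set of $\mathbf{x}\in\mathcal{F}_{\mathcal{T}}$ satisfying $\sum_{e\in s(i)}x_e\le v^{(s(i),\alpha)}$ for every $i\in V$ and every nonempty $s(i)\subseteq\delta(i)$ such that $v^{(s(i)\cup\{\{i,k\}\},\alpha)}>v^{(s(i),\alpha)}$ for every $\{i,k\}\in\delta(i)\setminus s(i)$. For a polyhedron $\mathcal{F}$ in $\mathbf{x}$-space or $(\mathbf{x},\mathbf{y})$-space, $w(\mathcal{F})$ is the minimum of $\sum_{e\in E}w_ex_e$ over $\mathcal{F}$ (with value $+\infty$ if $\mathcal{F}=\emptyset$). *)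

(* Defs.v *)
From mathcomp Require Import all_boot all_order all_algebra.
From mathcomp Require Import all_classical all_reals all_analysis.
From mathcomp Require Import lra.
Set Implicit Arguments.
Unset Strict Implicit.
Unset Printing Implicit Defensive.
Import Order.TTheory GRing.Theory Num.Theory.
Local Open Scope ring_scope.

Definition edge (V : finType) := {e : {set V} | #|e| == 2}.

Definition dart (V : finType) := {p : V * V | p.1 != p.2}.

Definition edist (R : realType) (p q : R * R) : R :=
  Num.sqrt ((q.1 - p.1) ^+ 2 + (q.2 - p.2) ^+ 2).

(* The enumeration order of the two endpoints is irrelevant, edist being
   symmetric; every edge falls in the first branch. *)
Definition weight (R : realType) (V : finType) (pos : V -> R * R)
    (e : edge V) : R :=
  if enum (val e) is [:: i; j] then edist (pos i) (pos j) else 0.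

Definition delta (V : finType) (i : V) : {set edge V} :=
  [set e : edge V | i \in val e]%SET.

Definition is_angle0 (R : realType) (p q : R * R) (t : R) : Prop :=
  [/\ 0 <= t < 2 * pi,
      q.1 - p.1 = edist p q * cos t &
      q.2 - p.2 = edist p q * sin t].

(* When p <> q there is exactly one such t (angle0P gives existence), so the
   choice and the default 0 play no role. *)
Definition angle0 (R : realType) (p q : R * R) : R :=
  xget 0 [set t | is_angle0 p q t]%classic.

Lemma angle0P (R : realType) (p q : R * R) :
  p <> q -> is_angle0 p q (angle0 p q).
Proof.
move=> pq.
suff [t ht] : exists t, is_angle0 p q t by exact: (xgetPex 0 (ex_intro _ t ht)).
set a := q.1 - p.1; set b := q.2 - p.2.
set r := edist p q.
have r2 : r ^+ 2 = a ^+ 2 + b ^+ 2.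
  by rewrite sqr_sqrtr// addr_ge0// sqr_ge0.
have r0 : 0 < r.
  rewrite sqrtr_gt0 lt_def addr_ge0 ?sqr_ge0// andbT.
  apply/eqP => /eqP; rewrite paddr_eq0 ?sqr_ge0// !sqrf_eq0 !subr_eq0.
  move=> /andP[/eqP e1 /eqP e2]; apply: pq.
  by rewrite (surjective_pairing p) (surjective_pairing q) e1 e2.
have rN0 : r != 0 by rewrite gt_eqF.
have c2 : (a / r) ^+ 2 + (b / r) ^+ 2 = 1.
  by rewrite !expr_div_n -mulrDl -r2 divff// sqrf_eq0.
have c1 : -1 <= a / r <= 1.
  rewrite -ler_norml -(@expr_le1 _ 2)// -normrX ger0_norm ?sqr_ge0//.
  by rewrite -c2 lerDl sqr_ge0.
have sE : sin (acos (a / r)) = `|b / r|.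
  by rewrite sin_acos// -c2 addrC addKr sqrtr_sqr.
have pi0 := pi_gt0 R.
have [b0|b0] := leP 0 b.
  exists (acos (a / r)); split.
  - rewrite acos_ge0//=; apply: le_lt_trans (acos_lepi c1) _; lra.
  - by rewrite acosK ?in_itv//= mulrC divfK.
  - by rewrite sE ger0_norm ?divr_ge0 ?(ltW r0)// mulrC divfK.
have t0 : 0 < acos (a / r).
  rewrite lt_def acos_ge0// andbT; apply/eqP => t0.
  move: sE; rewrite t0 sin0 => /esym/eqP; rewrite normr_eq0 mulf_eq0 invr_eq0.
  by rewrite (lt_eqF b0) (negbTE rN0).
have tpi := acos_lepi c1.
exists (2 * pi - acos (a / r)).
have -> : 2 * pi - acos (a / r) = - acos (a / r) + pi *+ 2 by rewrite mulr2n; lra.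
rewrite /is_angle0 cosD2pi sinD2pi cosN sinN; split.
- apply/andP; split; rewrite mulr2n; lra.
- by rewrite acosK ?in_itv//= mulrC divfK.
- rewrite sE ltr0_norm ?opprK; first by rewrite mulrC divfK.
  by rewrite pmulr_llt0 ?invr_gt0.
Qed.

(* The anti-clockwise rotation, in [0, 2 pi[, from the ray i -> j to the ray
   i -> k; the vertex of the angle is the middle argument. *)
Definition angle (R : realType) (V : finType) (pos : V -> R * R)
    (j i k : V) : R :=
  let a := angle0 (pos i) (pos j) in
  let b := angle0 (pos i) (pos k) in
  if a <= b then b - a else 2 * pi + b - a.

Definition Lset (R : realType) (V : finType) (pos : V -> R * R) (alpha : R)
    (i j : V) : {set V} :=
  (j |: [set k | [&& k != i, k != j & (angle pos k i j <= alpha)%R]])%SET.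

Definition tree_polytope (R : realType) (V : finType) : set (edge V -> R) :=
  [set x | [/\ \sum_(e : edge V) x e = #|V|%:R - 1,
               forall S : {set V}, S != finset.set0 -> S \proper [set: V]%SET ->
                 \sum_(e : edge V | val e \subset S) x e <= #|S|%:R - 1 &
               forall e : edge V, 0 <= x e]]%classic.

Definition Fxy (R : realType) (V : finType) (pos : V -> R * R) (alpha : R) :
    set ((edge V -> R) * (dart V -> R)) :=
  [set p | let: (x, y) := p in
    [/\ tree_polytope x,
        forall i : V, \sum_(d : dart V | (val d).1 == i) y d = 1,
        forall (i j : V) (e : edge V), val e = [set i; j]%SET ->
          x e <= \sum_(d : dart V | ((val d).1 == i) &&
                          ((val d).2 \in Lset pos alpha i j)) y d &
        forall d : dart V, 0 <= y d]]%classic.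

Definition vcount (R : realType) (V : finType) (pos : V -> R * R) (alpha : R)
    (i : V) (s : {set edge V}) (j : V) : nat :=
  #|[set e in s | [exists k : V, (val e == [set i; k]) &&
                                 (angle pos j i k <= alpha)%R]]%SET|.

(* Used only for nonempty s \subset delta i, so that the maximum is over a
   nonempty family. *)
Definition vmax (R : realType) (V : finType) (pos : V -> R * R) (alpha : R)
    (i : V) (s : {set edge V}) : nat :=
  (\max_(j : V | [exists e in s, val e == [set i; j]%SET])
     vcount pos alpha i s j)%N.

Definition Fx (R : realType) (V : finType) (pos : V -> R * R) (alpha : R) :
    set (edge V -> R) :=
  [set x | tree_polytope x /\
    forall (i : V) (s : {set edge V}),
      s != finset.set0 -> s \subset delta i ->
      (forall e : edge V, e \in delta i :\: s ->
         (vmax pos alpha i s < vmax pos alpha i (e |: s))%N) ->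
      \sum_(e in s) x e <= (vmax pos alpha i s)%:R]%classic.

Definition proj_x (R : realType) (V : finType)
    (F : set ((edge V -> R) * (dart V -> R))) : set (edge V -> R) :=
  [set x | exists y : dart V -> R, F (x, y)]%classic.

Definition cost (R : realType) (V : finType) (pos : V -> R * R)
    (x : edge V -> R) : R :=
  \sum_(e : edge V) weight pos e * x e.

(* An attained minimum, not merely an infimum; +oo on the empty set. *)
Definition is_min_value (R : realType) (T : Type) (f : T -> R) (F : set T)
    (v : \bar R) : Prop :=
  (F = classical_sets.set0 /\ v = +oo%E) \/
  (exists p : T, [/\ F p, forall q : T, F q -> f p <= f q & v = (f p)%:E]).

(* Main.v *)
Require Import Defs.
From mathcomp Require Import all_boot all_order all_algebra.
From mathcomp Require Import all_classical all_reals all_analysis.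
From mathcomp Require Import lra.
Import Order.TTheory GRing.Theory Num.Theory.
Import numFieldNormedType.Exports.
Local Open Scope ring_scope.

(** Fix a vertex [i], a nonempty set [s] of edges at [i], and a point [(x, y)]
    of the extended polyhedron.  Bound every [x e], for [e = {i, j}] in [s], by
    the sum of the [y (i, k)] over the [k] in [L_ij], and exchange the two
    sums: [y (i, k)] is then counted once for each edge of [s] in the closed
    sector of angle [alpha] that starts at the ray [i -> k] and opens
    anti-clockwise, that is [vcount pos alpha i s k] times.  As the
    [y (i, k)] are nonnegative and sum to 1, the inequality of [Fx] follows
    once [vcount pos alpha i s k <= vmax pos alpha i s] for every [k != i].

    By definition [vmax] is the maximum of these counts over the [k] with
    [{i, k}] in [s] only, so the geometric content is [vcount_le_vmax]: rotate
    the start of the sector anti-clockwise from [i -> k] to the first edge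
    [{i, j}] of [s].  No edge of [s] is met on the way, hence none is lost.

    For the optimal values, both polyhedra are closed and lie in a box, hence
    are compact for the product topology; so the continuous cost attains its
    minimum on each of them unless it is empty, and the comparison of the
    minima is the inclusion just described. *)

(** * Angles at a vertex *)

Section Angles.
Variables (R : realType) (V : finType) (pos : V -> R * R) (alpha : R).
Hypothesis pos_inj : injective pos.

Lemma angle0_range (i j : V) : j != i ->
  0 <= angle0 (pos i) (pos j) < 2 * pi.
Proof.
move=> ji; have /angle0P[] // : pos i <> pos j.
by move/pos_inj/eqP; rewrite eq_sym (negbTE ji).
Qed.

Lemma angle_refl (i j : V) : angle pos j i j = 0.
Proof. by rewrite /angle lexx subrr. Qed.

(** The hypothesis on the angles says that the anti-clockwise rotation from [k]
    to [l] passes through [j]; the rotation from [j] to [l] is the rest of it.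
    Angles being reduced to [0, 2 pi[, this has to be checked
    for each order of the three directions. *)
Lemma angle_le_of_between (i j k l : V) : j != i -> k != i -> l != i ->
  angle pos k i j <= angle pos k i l -> angle pos j i l <= angle pos k i l.
Proof.
move=> /angle0_range + /angle0_range + /angle0_range; rewrite /angle.
set a := angle0 _ (pos j); set b := angle0 _ (pos k); set c := angle0 _ (pos l).
by case: (leP b a); case: (leP b c); case: (leP a c); lra.
Qed.

Lemma delta_edge (i : V) (e : edge V) : e \in delta i ->
  exists2 j, j != i & val e = [set i; j]%SET.
Proof.
rewrite inE => ie; have /cards2P[a [b [ab eab]]] := valP e.
move: ie; rewrite [val e]eab in_set2 => /orP[]/eqP ->.
  by exists b; rewrite 1?eq_sym.
by exists a; rewrite // finset.setUC.
Qed.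

(** The sector starting at [k] loses no edge of [s] when its start is rotated
    anti-clockwise to the first edge of [s], where the count is one of those
    over which [vmax] is taken. *)
Lemma vcount_le_vmax (i : V) (s : {set edge V}) (k : V) :
  s != finset.set0 -> s \subset delta i -> k != i ->
  (vcount pos alpha i s k <= vmax pos alpha i s)%N.
Proof.
move=> /finset.set0Pn[e0 e0s] /fintype.subsetP sd ki.
pose nbr j := [exists e in s, val e == [set i; j]%SET].
have nbrN j : nbr j -> j != i.
  case/exists_inP => e _ /eqP ej; apply: contraTneq (valP e) => ji.
  by rewrite [val e]ej ji finset.setUid cards1.
have [j0 _ ej0] := delta_edge _ _ (sd _ e0s).
have j0s : nbr j0 by apply/exists_inP; exists e0; rewrite ?ej0.
case: (Order.TotalTheory.arg_minP (fun j => angle pos k i j) j0s) => j js jmin.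
apply: (@leq_trans (vcount pos alpha i s j)); last exact: leq_bigmax_cond.
apply/subset_leq_card/fintype.subsetP => e; rewrite !inE => /andP[es].
case/existsP => l /andP[el kl]; rewrite es; apply/existsP; exists l.
have ls : nbr l by apply/exists_inP; exists e.
rewrite el; apply: le_trans kl.
by apply: angle_le_of_between; [exact: nbrN|exact: ki|exact: nbrN|exact: jmin].
Qed.

(** * Projection onto the x-space *)

Lemma proj_Fxy_sub_Fx : 0 <= alpha ->
  (proj_x (Fxy pos alpha) `<=` Fx pos alpha)%classic.
Proof.
move=> alpha0 x [y [tx y1 xy y0]]; split=> // i s s0 sd _.
pose in_sector (e : edge V) (d : dart V) :=
  [exists k, (val e == [set i; k]%SET) && (angle pos (val d).2 i k <= alpha)].
have xle e : e \in s -> x e <= \sum_(d | ((val d).1 == i) && in_sector e d) y d.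
  move=> /(fintype.subsetP sd)/(delta_edge _ _)[j ji ej].
  apply: le_trans (xy i j e ej) _.
  rewrite [leLHS]big_mkcond [leRHS]big_mkcond; apply: ler_sum => d _.
  case: eqP => //= _; case: ifPn => [dL|_]; last by case: ifP.
  suff -> : in_sector e d by [].
  apply/existsP; exists j; rewrite ej eqxx /=.
  move: dL; rewrite !inE => /orP[/eqP ->|/and3P[]//].
  by rewrite angle_refl.
apply: le_trans (ler_sum _ xle) _.
rewrite (exchange_big_dep (fun d : dart V => (val d).1 == i)) /=; last first.
  by move=> e d _ /andP[].
rewrite -[leRHS]mulr1 -[X in _ * X](y1 i) mulr_sumr.
apply: ler_sum => d /eqP di.
rewrite sumr_const -[leLHS]mulr_natl ler_wpM2r// ler_nat.
have di2 : (val d).2 != i by rewrite -di eq_sym; exact: (valP d).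
apply: leq_trans (vcount_le_vmax _ _ _ s0 sd di2).
apply: subset_leq_card; apply/fintype.subsetP => e.
by rewrite !inE unfold_in /= di eqxx.
Qed.

End Angles.

(** * Closed and compact sets of functions *)

Section Minima.
Local Open Scope classical_set_scope.

Lemma continuous_sum (R : realType) (T : topologicalType) (I : finType)
    (P : pred I) (f : I -> T -> R) :
  (forall i, continuous (f i)) -> continuous (fun t => \sum_(i | P i) f i t).
Proof.
move=> cf; elim: (index_enum I) => [|i r IH].
  rewrite (_ : (fun t => _) = cst 0); first exact: cst_continuous.
  by apply/funext => t; rewrite big_nil.
rewrite (_ : (fun t => _) =
    (fun t => (if P i then f i t else 0) + \sum_(j <- r | P j) f j t));
  last first.
  by apply/funext => t; rewrite big_cons; case: (P i); rewrite ?add0r.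
move=> t; apply: cvgD; last exact: IH.
by case: (P i); [exact: cf|exact: cvg_cst].
Qed.

Lemma compact_min_value (R : realType) (T : topologicalType) (f : T -> R)
    (F : set T) :
  compact F -> continuous f -> exists v : \bar R, is_min_value f F v.
Proof.
move=> cF cf; have [->|/set0P F0] := eqVneq F set0; first by exists +oo%E; left.
have [p /set_mem Fp pmin] := compact_EVT_min F0 cF (continuous_subspaceT cf).
by exists (f p)%:E; right; exists p; split => // q /mem_set; exact: pmin.
Qed.

Lemma closed_le_fun (R : realType) (T : topologicalType) (f g : T -> R) :
  continuous f -> continuous g -> closed [set t | f t <= g t].
Proof.
move=> cf cg.
rewrite (_ : mkset _ = (g - f) @^-1` [set r | 0 <= r]).
  apply: preimage_closed (@closed_ge R 0) => t _.
  by apply: continuousB; [exact: cg|exact: cf].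
by apply/funext => t /=; rewrite subr_ge0.
Qed.

Lemma closed_eq_fun (R : realType) (T : topologicalType) (f g : T -> R) :
  continuous f -> continuous g -> closed [set t | f t = g t].
Proof.
move=> cf cg.
rewrite (_ : mkset _ = [set t | f t <= g t] `&` [set t | g t <= f t]).
  by apply: closedI; exact: closed_le_fun.
apply/funext => t; apply/propext; split => /= [->|[fg gf]]; first by split.
by apply/eqP; rewrite eq_le fg.
Qed.

Lemma box_compact (R : realType) (I : finType) (M : R) :
  compact [set x : {ptws I -> R} | forall i, 0 <= x i <= M].
Proof.
exact: (@tychonoff I (fun=> R) (fun=> `[0, M]) (fun=> @segment_compact R 0 M)).
Qed.

Lemma closed_forall (T : topologicalType) (I : Type) (D : I -> Prop)
    (F : I -> T -> Prop) :
  (forall i, D i -> closed [set t | F i t]) ->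
  closed [set t | forall i, D i -> F i t].
Proof. by move=> cF; exact: (closed_bigI (f := fun i => [set t | F i t])). Qed.

Lemma ptws_eval_continuous (R : realType) (I : eqType) (i : I) :
  continuous (fun x : {ptws I -> R} => x i).
Proof. exact: (@proj_continuous I (fun=> R) i). Qed.

Lemma ptws_eval_fst_continuous (R : realType) (I J : eqType) (i : I) :
  continuous (fun p : {ptws I -> R} * {ptws J -> R} => p.1 i).
Proof.
by move=> p; apply: (@continuous_comp _ _ _ fst (fun x : {ptws I -> R} => x i));
  [exact: cvg_fst|exact: ptws_eval_continuous].
Qed.

Lemma ptws_eval_snd_continuous (R : realType) (I J : eqType) (j : J) :
  continuous (fun p : {ptws I -> R} * {ptws J -> R} => p.2 j).
Proof.
by move=> p; apply: (@continuous_comp _ _ _ snd (fun y : {ptws J -> R} => y j));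
  [exact: cvg_snd|exact: ptws_eval_continuous].
Qed.

(** * Compactness of the polyhedra and continuity of the cost *)

(** The vector [x] is a function of a parameter [t] so that the lemma serves
    both in the [x]-space and in the [(x, y)]-space. *)
Lemma closed_tree_polytope (R : realType) (V : finType) (T : topologicalType)
    (x : T -> edge V -> R) :
  (forall e, continuous (x^~ e)) -> closed [set t | tree_polytope (x t)].
Proof.
move=> cx.
rewrite (_ : mkset _ = [set t | \sum_(e : edge V) x t e = #|V|%:R - 1] `&`
   [set t | forall S : {set V}, S != finset.set0 /\ S \proper [set: V]%SET ->
       \sum_(e : edge V | val e \subset S) x t e <= #|S|%:R - 1] `&`
   [set t | forall e, True -> 0 <= x t e]); last first.
  apply/funext => t; apply/propext; split.
    case=> h1 h2 h3; split; last by move=> e _; exact: h3.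
    by split=> // S [S0 ST]; exact: h2.
  case=> -[h1 h2] h3; split=> //; last by move=> e; exact: h3.
  by move=> S S0 ST; exact: h2.
apply: closedI; [apply: closedI|].
- by apply: closed_eq_fun; [exact: continuous_sum|exact: cst_continuous].
- apply: closed_forall => S _.
  by apply: closed_le_fun; [exact: continuous_sum|exact: cst_continuous].
- apply: closed_forall => e _.
  by apply: closed_le_fun; [exact: cst_continuous|exact: cx].
Qed.

Lemma tree_polytope_box (R : realType) (V : finType) (x : edge V -> R) e :
  tree_polytope x -> 0 <= x e <= #|V|%:R.
Proof.
case=> xV _ x0; rewrite x0 /=.
apply: (@le_trans _ _ (\sum_e x e)); last by rewrite xV lerBlDr lerDl.
by rewrite (bigD1 e)//= lerDl sumr_ge0.
Qed.

Section Polyhedra.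
Variables (R : realType) (V : finType) (pos : V -> R * R) (alpha : R).

(** Rewriting the set makes each family of constraints an intersection of
    closed half-spaces over a single index, the form [closed_forall] handles;
    a pair is used as index when a family has several. *)
Lemma Fx_compact : compact (Fx pos alpha : set {ptws edge V -> R}).
Proof.
apply: subclosed_compact (box_compact R (edge V) #|V|%:R) _; last first.
  by move=> x [tx _] e; exact: tree_polytope_box.
rewrite (_ : Fx pos alpha = [set x | tree_polytope x] `&`
  [set x | forall i_s : V * {set edge V},
      [/\ i_s.2 != finset.set0, i_s.2 \subset delta i_s.1 &
      forall e : edge V, e \in delta i_s.1 :\: i_s.2 ->
         (vmax pos alpha i_s.1 i_s.2 < vmax pos alpha i_s.1 (e |: i_s.2))%N] ->
      \sum_(e in i_s.2) x e <= (vmax pos alpha i_s.1 i_s.2)%:R]); last first.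
  apply/funext => x; apply/propext; split=> -[tx h]; split=> //.
    by move=> [i s] [s0 sd sm]; exact: h.
  by move=> i s s0 sd sm; exact: (h (i, s)).
apply: closedI.
  apply: (@closed_tree_polytope R V {ptws edge V -> R} id) => e.
  exact: ptws_eval_continuous.
apply: (@closed_forall {ptws edge V -> R}) => -[i s] _ /=.
apply: closed_le_fun; last exact: cst_continuous.
by apply: continuous_sum => e; exact: ptws_eval_continuous.
Qed.

(** The constraints alone bound the polyhedron: the [y]-values at a vertex are
    nonnegative of sum 1, and each [x e] is at most [#|V| - 1]. *)
Lemma Fxy_compact :
  compact (Fxy pos alpha : set ({ptws edge V -> R} * {ptws dart V -> R})%type).
Proof.
have boxc := compact_setX (box_compact R (edge V) #|V|%:R)
                          (box_compact R (dart V) 1).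
apply: subclosed_compact boxc _; last first.
  move=> [x y] [tx y1 _ y0]; split=> [e|d] /=; first exact: tree_polytope_box.
  rewrite y0 -(y1 (val d).1) (bigD1 d)//= lerDl sumr_ge0 // => d' _; exact: y0.
rewrite (_ : Fxy pos alpha = [set p | tree_polytope p.1] `&`
  [set p | forall i : V, True ->
     \sum_(d : dart V | (val d).1 == i) p.2 d = 1] `&`
  [set p | forall ije : V * V * edge V,
     val ije.2 = [set ije.1.1; ije.1.2]%SET ->
     p.1 ije.2 <= \sum_(d : dart V | ((val d).1 == ije.1.1) &&
             ((val d).2 \in Lset pos alpha ije.1.1 ije.1.2)) p.2 d] `&`
  [set p | forall d, True -> 0 <= p.2 d]); last first.
  apply/funext => -[x y]; apply/propext; split.
    case=> h1 h2 h3 h4; split; last by move=> d _; exact: h4.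
    split; last by move=> [[i j] e]; exact: h3.
    by split=> // i _; exact: h2.
  case=> -[[h1 h2] h3] h4; split=> //.
  - by move=> i; exact: h2.
  - by move=> i j e; exact: (h3 (i, j, e)).
  - by move=> d; exact: h4.
apply: closedI; [apply: closedI; [apply: closedI|]|].
- by apply: closed_tree_polytope => e; exact: ptws_eval_fst_continuous.
- apply: closed_forall => i _.
  apply: closed_eq_fun; last exact: cst_continuous.
  by apply: continuous_sum => d; exact: ptws_eval_snd_continuous.
- apply: closed_forall => -[[i j] e] _ /=.
  apply: closed_le_fun; first exact: ptws_eval_fst_continuous.
  by apply: continuous_sum => d; exact: ptws_eval_snd_continuous.
- apply: closed_forall => d _.
  apply: closed_le_fun; first exact: cst_continuous.
  exact: ptws_eval_snd_continuous.
Qed.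

Lemma cost_continuous (T : topologicalType) (x : T -> edge V -> R) :
  (forall e, continuous (x^~ e)) -> continuous (fun t => cost pos (x t)).
Proof.
move=> cx.
apply: (@continuous_sum R T _ _ (fun e t => weight pos e * x t e)) => e t.
by apply: cvgM; [exact: cvg_cst|exact: cx].
Qed.

End Polyhedra.

End Minima.

Theorem theorem1 (R : realType) (V : finType) (pos : V -> R * R) (alpha : R)
    (pos_inj : injective pos) (alpha_gt0 : 0 < alpha)
    (alpha_le : alpha <= 2 * pi) :
  (proj_x (Fxy pos alpha) `<=` Fx pos alpha)%classic /\
  exists wx wxy : \bar R,
    [/\ is_min_value (cost pos) (Fx pos alpha) wx,
        is_min_value (fun p => cost pos p.1) (Fxy pos alpha) wxy &
        (wx <= wxy)%E].
Proof.
have sub := proj_Fxy_sub_Fx _ _ _ alpha pos_inj (ltW alpha_gt0).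
split=> //.
have [wx minx] : exists wx, is_min_value (cost pos) (Fx pos alpha) wx.
  apply: (@compact_min_value R {ptws edge V -> R}); first exact: Fx_compact.
  apply: (@cost_continuous R V pos {ptws edge V -> R}) => e.
  exact: ptws_eval_continuous.
have [wxy minxy] : exists wxy,
    is_min_value (fun p => cost pos p.1) (Fxy pos alpha) wxy.
  apply: (@compact_min_value R ({ptws edge V -> R} * {ptws dart V -> R})%type).
    exact: Fxy_compact.
  apply: (@cost_continuous R V pos
            ({ptws edge V -> R} * {ptws dart V -> R})%type) => e.
  exact: ptws_eval_fst_continuous.
exists wx, wxy; split=> //.
case: minxy => [[_ ->]|[[x y] [Fxy_xy _ ->]]]; first exact: leey.
have Fx_x : Fx pos alpha x by apply: sub; exists y.
case: minx => [[Fx0 _]|[x' [_ x'min ->]]]; first by rewrite Fx0 in Fx_x.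
by rewrite lee_fin; exact: x'min.
Qed.
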